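(* Let $0\le\beta\le 1$. Then the function $$x\mapsto 1+\frac{1}{x}\log\Gamma(x+1)-\log(x+\beta)$$ is completely monotone on $(0,\infty)$.
   Context: A function $f:I\to\mathbb{R}$ on an interval $I\subseteq\mathbb{R}$ is called completely monotone if it has derivatives of all orders and $(-1)^n f^{(n)}(x)\ge 0$ for all $n=0,1,2,\ldots$ and all $x\in I$. $\Gamma$ is the Gamma function. *)

(* Defs.v *)
From Stdlib Require Import Reals.
From Coquelicot Require Import Coquelicot.
Open Scope R_scope.

(* Euler's integral, improper at both ends; it converges, and hence represents
   the Gamma function, exactly for 0 < x. *)
Definition Gamma (x : R) : R :=
  RInt_gen (fun t => Rpower t (x - 1) * exp (- t))
           (at_right 0) (Rbar_locally p_infty).

(* The interval is the open interval ]a, b[, so that the two-sided derivatives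
   at its points depend only on the values of f inside it. *)
Definition completely_monotone (a b : Rbar) (f : R -> R) : Prop :=
  forall (n : nat) (x : R), Rbar_lt a x -> Rbar_lt x b ->
    ex_derive_n f n x /\ 0 <= (-1) ^ n * Derive_n f n x.

(* Main.v *)
Require Import Defs.
From Stdlib Require Import Reals Lra Lia Factorial PSeries_reg.
From Coquelicot Require Import Coquelicot.
Open Scope R_scope.

(* Since [ln (x + 1) - ln (x + beta)] is completely monotone, it suffices to treat
   beta = 1.  With h_a(x) = (x + a) (ln (x + a + 1) - ln (x + a)), Abel summation and
   the asymptotics ln Gamma(y + x) - ln Gamma(y) - x ln y = O(1/y) give
     1 + ln Gamma(x + 1) / x - ln (x + 1) = sum_{a >= 1} (h_a(x) - h_a(0)) / x.
   Each term is the average over [0, x] of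
     h_a'(y) = ln (y + a + 1) - ln (y + a) - 1 / (y + a + 1),
   whose alternating derivatives are nonnegative by Bernoulli's inequality, and averaging
   preserves complete monotonicity.  A pointwise convergent series of completely monotone
   functions can be differentiated term by term, because a nonnegative convex decreasing u
   satisfies -u'(x) <= (2/x) u(x/2). *)

(** * Series of completely monotone functions *)

Lemma locally_Rlt (a x : R) : a < x -> locally x (fun y : R => a < y).
Proof. exact (open_gt a x). Qed.

(** By induction the [m]-th derivative of [F 0] is [(-1) ^ m * F m], so the two signs cancel.
    Complete monotonicity can thus be shown by exhibiting all signed derivatives at once. *)
Lemma completely_monotone_of_derivatives (a : R) (F : nat -> R -> R) :
  (forall m x, a < x -> 0 <= F m x) ->
  (forall m x, a < x -> is_derive (F m) x (- F (S m) x)) ->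
  completely_monotone a p_infty (F 0%nat).
Proof.
  intros Hpos Hder.
  assert (HD : forall m x, a < x -> Derive_n (F 0%nat) m x = (-1) ^ m * F m x).
  { induction m as [|m IH]; intros x Hx; simpl; [ring|].
    apply is_derive_unique.
    apply is_derive_ext_loc with (fun y => (-1) ^ m * F m y).
    - apply (filter_imp (fun y => a < y)); [|now apply locally_Rlt].
      intros y Hy; symmetry; now apply IH.
    - replace (-1 * (-1) ^ m * F (S m) x) with ((-1) ^ m * - F (S m) x) by ring.
      apply is_derive_scal; now apply Hder. }
  intros m x Hx _; simpl in Hx; split.
  - destruct m as [|m]; [exact I|]; simpl.
    apply ex_derive_ext_loc with (fun y => (-1) ^ m * F m y).
    + apply (filter_imp (fun y => a < y)); [|now apply locally_Rlt].
      intros y Hy; symmetry; now apply HD.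
    + apply ex_derive_scal; eexists; now apply Hder.
  - rewrite HD by assumption.
    rewrite <- Rmult_assoc, <- Rpow_mult_distr.
    replace (-1 * -1) with 1 by ring; rewrite pow1, Rmult_1_l; now apply Hpos.
Qed.

Lemma completely_monotone_ext (a : R) (f g : R -> R) :
  (forall x, a < x -> f x = g x) ->
  completely_monotone a p_infty f -> completely_monotone a p_infty g.
Proof.
  intros Heq Hf n x Hx Hx'; destruct (Hf n x Hx Hx') as [Hex Hpos].
  assert (L : locally x (fun y : R => f y = g y)).
  { apply (filter_imp (fun y => a < y)); [exact Heq | now apply locally_Rlt]. }
  split.
  - now apply ex_derive_n_ext_loc with f.
  - now rewrite <- (Derive_n_ext_loc f g n x L).
Qed.

Definition signed_derivative (f : R -> R) (m : nat) (x : R) : R :=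
  (-1) ^ m * Derive_n f m x.

Lemma signed_derivative_ge0 (a : R) (f : R -> R) (m : nat) (x : R) :
  completely_monotone a p_infty f -> a < x -> 0 <= signed_derivative f m x.
Proof. intros Hf Hx; now apply (Hf m x Hx I). Qed.

Lemma is_derive_signed_derivative (a : R) (f : R -> R) (m : nat) (x : R) :
  completely_monotone a p_infty f -> a < x ->
  is_derive (signed_derivative f m) x (- signed_derivative f (S m) x).
Proof.
  intros Hf Hx; unfold signed_derivative.
  replace (- ((-1) ^ S m * Derive_n f (S m) x))
    with ((-1) ^ m * Derive_n f (S m) x) by (simpl; ring).
  apply is_derive_scal, Derive_correct, (proj1 (Hf (S m) x Hx I)).
Qed.

Lemma antitone_of_derive_le0 (a : R) (f df : R -> R) (x y : R) :
  (forall z, a < z -> is_derive f z (- df z)) -> (forall z, a < z -> 0 <= df z) ->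
  a < x <= y -> f y <= f x.
Proof.
  intros Hd Hpos Hxy.
  destruct (MVT_gen f x y (fun z => - df z)) as [c [Hc E]].
  - intros z Hz; rewrite Rmin_left in Hz by lra; apply Hd; lra.
  - intros z Hz; rewrite Rmin_left in Hz by lra.
    apply derivable_continuous_pt; exists (- df z); apply is_derive_Reals, Hd; lra.
  - rewrite Rmin_left, Rmax_right in Hc by lra.
    assert (0 <= df c) by (apply Hpos; lra); nra.
Qed.

Lemma antitone_derive_bound (f df : R -> R) (x : R) :
  (forall z, 0 < z -> is_derive f z (- df z)) -> (forall z, 0 < z -> 0 <= f z) ->
  (forall y z, 0 < y <= z -> df z <= df y) ->
  0 < x -> df x <= 2 / x * f (x / 2).
Proof.
  intros Hd Hpos Hanti Hx.
  destruct (MVT_gen f (x / 2) x (fun z => - df z)) as [c [Hc E]].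
  - intros z Hz; rewrite Rmin_left in Hz by lra; apply Hd; lra.
  - intros z Hz; rewrite Rmin_left in Hz by lra.
    apply derivable_continuous_pt; exists (- df z); apply is_derive_Reals, Hd; lra.
  - rewrite Rmin_left, Rmax_right in Hc by lra.
    assert (df x <= df c) by (apply Hanti; lra).
    assert (0 <= f x) by now apply Hpos.
    apply Rmult_le_reg_l with (x / 2); [lra|].
    replace (x / 2 * (2 / x * f (x / 2))) with (f (x / 2)) by (field; lra); nra.
Qed.

Lemma Series_ge0 (u : nat -> R) :
  (forall k, 0 <= u k) -> ex_series u -> 0 <= Series u.
Proof.
  intros Hu Hex; replace 0 with (Series (fun _ : nat => 0)).
  - apply Series_le; [intro k; split; [lra | apply Hu] | exact Hex].
  - rewrite (Series_ext _ (fun k => 0 * u k)) by (intro; ring).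
    now rewrite Series_scal_l, Rmult_0_l.
Qed.

(** The error is a tail of [u], dominated by the same tail of [M]. The bound depends on [M] only, as
    in the Weierstrass test, which yields uniformity. *)
Lemma Series_tail_le (u M : nat -> R) (n : nat) :
  (forall k, 0 <= u k <= M k) -> ex_series M ->
  Rabs (Series u - sum_n u n) <= Series M - sum_n M n.
Proof.
  intros Hu HM.
  assert (Hu' : ex_series u).
  { apply (ex_series_le u M); [|exact HM].
    intro k; change (Rabs (u k) <= M k); rewrite Rabs_pos_eq; apply Hu. }
  rewrite (Series_incr_n u (S n)), (Series_incr_n M (S n)) by (lia || assumption).
  simpl Nat.pred; rewrite !sum_n_Reals.
  assert (HM' : ex_series (fun k => M (S n + k)%nat)) by now apply (ex_series_incr_n M (S n)).
  replace (sum_f_R0 u n + Series (fun k => u (S n + k)%nat) - sum_f_R0 u n)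
    with (Series (fun k => u (S n + k)%nat)) by ring.
  replace (sum_f_R0 M n + Series (fun k => M (S n + k)%nat) - sum_f_R0 M n)
    with (Series (fun k => M (S n + k)%nat)) by ring.
  rewrite Rabs_pos_eq.
  - apply Series_le; [intro k; apply Hu | exact HM'].
  - apply Series_ge0; [intro k; apply Hu|].
    now apply (ex_series_incr_n u (S n)).
Qed.

(** Comparison with [2 / y * u k (y / 2)] makes the differentiated series converge. Near [x] its
    terms are dominated by their values at [x / 2], so convergence is uniform there and termwise
    differentiation is allowed. *)
Lemma is_derive_Series_antitone (u v : nat -> R -> R) (x : R) :
  (forall k y, 0 < y -> is_derive (u k) y (- v k y)) ->
  (forall k y, 0 < y -> 0 <= u k y) -> (forall k y, 0 < y -> 0 <= v k y) ->
  (forall k y z, 0 < y <= z -> v k z <= v k y) ->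
  (forall y, 0 < y -> ex_series (fun k => u k y)) ->
  0 < x ->
  ex_series (fun k => v k x) /\
  is_derive (fun y => Series (fun k => u k y)) x (- Series (fun k => v k x)).
Proof.
  intros Hd Hu Hv Hanti Hex Hx.
  assert (Hexv : forall y, 0 < y -> ex_series (fun k => v k y)).
  { intros y Hy.
    apply (ex_series_le (fun k => v k y) (fun k => 2 / y * u k (y / 2))).
    - intro k; change (Rabs (v k y) <= 2 / y * u k (y / 2)).
      rewrite Rabs_pos_eq by now apply Hv.
      now apply antitone_derive_bound; auto.
    - apply (ex_series_scal_l (2 / y) (fun k => u k (y / 2))), Hex; lra. }
  split; [now apply Hexv|].
  assert (Hr : 0 < x / 2) by lra.
  apply is_derive_Reals.
  (* The radius [x / 2] keeps the ball to the right of [x / 2], where [v k (x / 2)] is a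
     majorant. *)
  apply (CVU_derivable (fun n y => sum_n (fun k => u k y) n)
          (fun n y => - sum_n (fun k => v k y) n)
          (fun y => Series (fun k => u k y)) (fun y => - Series (fun k => v k y))
          x (mkposreal (x / 2) Hr)).
  - intros e He.
    assert (HM := Series_correct _ (Hexv _ Hr)).
    apply is_series_Reals in HM.
    destruct (HM e He) as [N HN]; exists N; intros n y Hn Hy.
    unfold Boule in Hy; simpl in Hy; apply Rabs_def2 in Hy.
    apply Rle_lt_trans with (Series (fun k => v k (x / 2)) - sum_n (fun k => v k (x / 2)) n).
    + replace (- Series (fun k => v k y) - - sum_n (fun k => v k y) n)
        with (- (Series (fun k => v k y) - sum_n (fun k => v k y) n)) by ring.
      rewrite Rabs_Ropp; apply Series_tail_le; [|now apply Hexv].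
      intro k; split; [apply Hv; lra | apply Hanti; lra].
    + specialize (HN n Hn); unfold Rdist in HN; apply Rabs_def2 in HN.
      rewrite sum_n_Reals; lra.
  - intros y Hy; unfold Boule in Hy; simpl in Hy; apply Rabs_def2 in Hy.
    apply is_lim_seq_Reals, (Series_correct (fun k => u k y)), Hex; lra.
  - intros n y Hy; unfold Boule in Hy; simpl in Hy; apply Rabs_def2 in Hy.
    apply is_derive_Reals.
    induction n as [|n IH].
    + rewrite sum_O; apply is_derive_ext with (u 0%nat); [|apply Hd; lra].
      intro t; now rewrite sum_O.
    + rewrite sum_Sn; unfold plus; simpl.
      apply is_derive_ext with (fun t => sum_n (fun k => u k t) n + u (S n) t).
      * intro t; now rewrite sum_Sn.
      * rewrite Ropp_plus_distr; apply (is_derive_plus (K := R_AbsRing) (V := R_NormedModule));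
          [exact IH | apply Hd; lra].
  - unfold Boule; simpl; rewrite Rminus_diag, Rabs_R0; exact Hr.
Qed.

(** Only the series of values is assumed to converge. Convergence passes from order [m] to order
    [m + 1] by [step], which also differentiates the sum. *)
Lemma completely_monotone_series (phi : nat -> R -> R) (f : R -> R) :
  (forall k, completely_monotone 0 p_infty (phi k)) ->
  (forall x, 0 < x -> is_series (fun k => phi k x) (f x)) ->
  completely_monotone 0 p_infty f.
Proof.
  intros Hphi Hser.
  assert (step : forall m,
    (forall x, 0 < x -> ex_series (fun k => signed_derivative (phi k) m x)) ->
    forall x, 0 < x ->
    ex_series (fun k => signed_derivative (phi k) (S m) x) /\
    is_derive (fun y => Series (fun k => signed_derivative (phi k) m y)) x
      (- Series (fun k => signed_derivative (phi k) (S m) x))).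
  { intros m Hm x Hx.
    apply (is_derive_Series_antitone (fun k => signed_derivative (phi k) m)
            (fun k => signed_derivative (phi k) (S m))); auto.
    - intros; now apply is_derive_signed_derivative with 0.
    - intros; now apply signed_derivative_ge0 with 0.
    - intros; now apply signed_derivative_ge0 with 0.
    (* Monotonicity at order [m + 1] comes from the sign at order [m + 2]. *)
    - intros k y z Hyz.
      apply antitone_of_derive_le0 with 0 (signed_derivative (phi k) (S (S m))); auto.
      + intros; now apply is_derive_signed_derivative with 0.
      + intros; now apply signed_derivative_ge0 with 0. }
  assert (Hex : forall m x, 0 < x -> ex_series (fun k => signed_derivative (phi k) m x)).
  { induction m as [|m IH]; intros x Hx; [|now apply step].
    exists (f x); apply (is_series_ext (fun k => phi k x)); [|now apply Hser].
    intro k; unfold signed_derivative; simpl; now rewrite Rmult_1_l. }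
  apply completely_monotone_ext
    with (fun x => Series (fun k => signed_derivative (phi k) 0 x)).
  - intros x Hx; apply is_series_unique.
    apply (is_series_ext (fun k => phi k x)); [|now apply Hser].
    intro k; unfold signed_derivative; simpl; now rewrite Rmult_1_l.
  - apply (completely_monotone_of_derivatives 0
            (fun m x => Series (fun k => signed_derivative (phi k) m x))).
    + intros m x Hx.
      apply Series_ge0; [|now apply Hex].
      intro k; now apply signed_derivative_ge0 with 0.
    + intros m x Hx; apply step; auto.
Qed.

(** * Averages and logarithms *)

Lemma completely_monotone_plus (a : R) (f g : R -> R) :
  completely_monotone a p_infty f -> completely_monotone a p_infty g ->
  completely_monotone a p_infty (fun x => f x + g x).
Proof.
  intros Hf Hg.
  apply completely_monotone_ext
    with (fun x => signed_derivative f 0 x + signed_derivative g 0 x).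
  { intros x _; unfold signed_derivative; simpl; ring. }
  apply (completely_monotone_of_derivatives a
          (fun m x => signed_derivative f m x + signed_derivative g m x)).
  - intros m x Hx; apply Rplus_le_le_0_compat; now apply signed_derivative_ge0 with a.
  - intros m x Hx; rewrite Ropp_plus_distr.
    apply (is_derive_plus (K := R_AbsRing) (V := R_NormedModule));
      now apply is_derive_signed_derivative with a.
Qed.

(* When [Psi] is the primitive of [psi] vanishing at 0, this is the integral over [0, x]
   of t^m (-1)^m psi^(m)(t); the recursion is integration by parts. *)
Fixpoint moment (Psi psi : R -> R) (m : nat) (x : R) : R :=
  match m with
  | O => Psi x
  | S p => INR (S p) * moment Psi psi p x - x ^ S p * signed_derivative psi p x
  end.

(** In the derivative of the recursion, the terms with factor [m + 1] cancel and only the one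
    differentiating [signed_derivative psi m] survives. *)
Lemma is_derive_moment (a : R) (Psi psi : R -> R) (m : nat) (x : R) :
  completely_monotone a p_infty psi -> (forall y, a < y -> is_derive Psi y (psi y)) ->
  a < x -> is_derive (moment Psi psi m) x (x ^ m * signed_derivative psi m x).
Proof.
  intros Hpsi Hd Hx; induction m as [|m IH].
  - unfold signed_derivative; simpl; rewrite !Rmult_1_l; now apply Hd.
  - assert (H := is_derive_signed_derivative a psi m x Hpsi Hx).
    change (moment Psi psi (S m)) with
      (fun y => INR (S m) * moment Psi psi m y - y ^ S m * signed_derivative psi m y).
    auto_derive.
    + repeat split; [eexists; exact IH | eexists; exact H].
    + assert (E := is_derive_unique _ _ _ IH : Derive (fun y => moment Psi psi m y) x = _).
      assert (E' := is_derive_unique _ _ _ H :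
        Derive (fun y => signed_derivative psi m y) x = _).
      rewrite E, E'.
      change (match m with 0%nat => 1 | S _ => INR m + 1 end) with (INR (S m)).
      rewrite S_INR; simpl; ring.
Qed.

(** [Psi x / x] is the mean of [psi] over [[0, x]]. Substituting [t = s x], its signed derivative of
    order [m] is the integral over [[0, 1]] of [s^m] times that of [psi] at [s x], that is,
    [moment Psi psi m x / x ^ S m]. Since [a < 0], the moments are differentiable at 0 as well. *)
Lemma completely_monotone_average (a : R) (Psi psi : R -> R) :
  a < 0 -> completely_monotone a p_infty psi ->
  (forall y, a < y -> is_derive Psi y (psi y)) -> Psi 0 = 0 ->
  completely_monotone 0 p_infty (fun x => Psi x / x).
Proof.
  intros Ha Hpsi Hd H0.
  apply completely_monotone_ext with (fun x => moment Psi psi 0 x / x ^ 1).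
  { intros x Hx; simpl; now rewrite Rmult_1_r. }
  apply (completely_monotone_of_derivatives 0 (fun m x => moment Psi psi m x / x ^ S m)).
  - intros m x Hx.
    apply Rmult_le_pos; [|apply Rlt_le, Rinv_0_lt_compat, pow_lt, Hx].
    (* All moments vanish at 0, so the mean value theorem on [[0, x]] transfers the sign of the
       derivative to the moment. *)
    replace 0 with (moment Psi psi m 0).
    2: { induction m as [|m IH]; [exact H0|].
         cbn [moment]; rewrite IH; simpl; ring. }
    destruct (MVT_gen (moment Psi psi m) 0 x
               (fun y => y ^ m * signed_derivative psi m y)) as [c [Hc E]].
    + intros z Hz; rewrite Rmin_left in Hz by lra.
      apply is_derive_moment with a; auto; lra.
    + intros z Hz; rewrite Rmin_left in Hz by lra.
      apply derivable_continuous_pt; eexists; apply is_derive_Reals.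
      apply is_derive_moment with a; auto; lra.
    + rewrite Rmin_left, Rmax_right in Hc by lra.
      assert (0 <= c ^ m * signed_derivative psi m c * (x - 0)); [|lra].
      apply Rmult_le_pos; [|lra].
      apply Rmult_le_pos; [apply pow_le; lra|].
      apply signed_derivative_ge0 with a; auto; lra.
  - intros m x Hx.
    assert (Hax : a < x) by lra.
    assert (H := is_derive_moment a Psi psi m x Hpsi Hd Hax).
    auto_derive.
    + repeat split; [eexists; exact H|].
      apply Rgt_not_eq; apply (pow_lt x (S m)), Hx.
    + assert (E := is_derive_unique _ _ _ H : Derive (fun y => moment Psi psi m y) x = _).
      rewrite E; cbn [moment].
      change (match m with 0%nat => 1 | S _ => INR m + 1 end) with (INR (S m)).
      simpl (x ^ _); field; split; [apply pow_nonzero|]; lra.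
Qed.

(** The [m]-th derivative of [1 / (x + a)], up to the sign [(-1) ^ m]. *)
Definition inv_power (a : R) (m : nat) (x : R) : R :=
  INR (fact m) / (x + a) ^ S m.

Lemma is_derive_inv_power (a : R) (m : nat) (x : R) :
  0 < x + a -> is_derive (inv_power a m) x (- inv_power a (S m) x).
Proof.
  intro Hx; unfold inv_power; auto_derive.
  - apply Rgt_not_eq, (pow_lt (x + a) (S m)), Hx.
  - change (match m with 0%nat => 1 | S _ => INR m + 1 end) with (INR (S m)).
    rewrite fact_simpl, mult_INR; simpl (_ ^ _); field.
    split; [apply pow_nonzero|]; lra.
Qed.

Lemma is_derive_ln_shift (a x : R) :
  0 < x + a -> is_derive (fun y => ln (y + a)) x (inv_power a 0 x).
Proof.
  intro Hx; unfold inv_power; auto_derive; [exact Hx|]; simpl; field; lra.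
Qed.

Lemma ln_le_sub1 (x : R) : 0 < x -> ln x <= x - 1.
Proof.
  intro Hx; assert (H := exp_ineq1_le (ln x)); rewrite exp_ln in H by exact Hx; lra.
Qed.

(** The concave [ln] lies below its tangent at [x]. Since [x] and [y] are not ordered, swapping them
    gives the matching lower bound. *)
Lemma ln_sub_le (x y : R) : 0 < x -> 0 < y -> ln y - ln x <= (y - x) / x.
Proof.
  intros Hx Hy; rewrite <- ln_div by assumption.
  replace ((y - x) / x) with (y / x - 1) by (field; lra).
  apply ln_le_sub1; now apply Rdiv_lt_0_compat.
Qed.

Lemma completely_monotone_ln_sub (a b : R) :
  a <= b -> completely_monotone (- a) p_infty (fun x => ln (x + b) - ln (x + a)).
Proof.
  intro Hab.
  apply (completely_monotone_of_derivatives (- a)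
    (fun m x => match m with
                | O => ln (x + b) - ln (x + a)
                | S p => inv_power a p x - inv_power b p x
                end)).
  - intros [|m] x Hx.
    + assert (ln (x + a) <= ln (x + b)) by (apply ln_le; lra); lra.
    + assert (inv_power b m x <= inv_power a m x); [|lra].
      apply Rmult_le_compat_l; [apply pos_INR|].
      apply Rinv_le_contravar; [apply pow_lt; lra | apply pow_incr; lra].
  - intros [|m] x Hx; rewrite Ropp_minus_distr.
    + apply (is_derive_minus (K := R_AbsRing) (V := R_NormedModule));
        apply is_derive_ln_shift; lra.
    + replace (inv_power b (S m) x - inv_power a (S m) x)
        with (- inv_power a (S m) x - - inv_power b (S m) x) by ring.
      apply (is_derive_minus (K := R_AbsRing) (V := R_NormedModule));
        apply is_derive_inv_power; lra.
Qed.

(** With [u = x + a], multiplying by [(u + 1)^(m+1) / m!] turns the claim into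
    [1 + (m+1)/(u+1) <= (1 + 1/u)^(m+1)], which follows from Bernoulli's inequality and
    [1/(u+1) <= 1/u]. *)
Lemma inv_power_sub_ge (a : R) (m : nat) (x : R) :
  0 < x + a -> inv_power (a + 1) (S m) x <= inv_power a m x - inv_power (a + 1) m x.
Proof.
  intro Hx; unfold inv_power; rewrite fact_simpl, mult_INR.
  set (u := x + a); replace (x + (a + 1)) with (u + 1) by (unfold u; ring).
  assert (Hu : 0 < u) by exact Hx.
  (* [poly] is Bernoulli's inequality. *)
  assert (B := poly (S m) (/ u) (Rinv_0_lt_compat _ Hu)).
  assert (Hp : 0 < (u + 1) ^ S m) by (apply pow_lt; lra).
  assert (Hq : 0 < u ^ S m) by (apply pow_lt; lra).
  replace (1 + / u) with ((u + 1) / u) in B by (field; lra).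
  unfold Rdiv in B; rewrite Rpow_mult_distr, pow_inv in B.
  assert (Hn := pos_INR (S m)).
  assert (B' : 1 + INR (S m) * / (u + 1) <= (u + 1) ^ S m * / u ^ S m).
  { apply Rle_trans with (2 := B), Rplus_le_compat_l, Rmult_le_compat_l; [exact Hn|].
    apply Rinv_le_contravar; lra. }
  apply Rmult_le_compat_r with (r := / (u + 1) ^ S m) in B';
    [|now apply Rlt_le, Rinv_0_lt_compat].
  apply Rmult_le_compat_l with (r := INR (fact m)) in B'; [|apply pos_INR].
  replace (INR (fact m) * ((u + 1) ^ S m * / u ^ S m * / (u + 1) ^ S m))
    with (INR (fact m) / u ^ S m) in B' by (field; lra).
  apply Rplus_le_reg_l with (INR (fact m) / (u + 1) ^ S m).
  replace (INR (fact m) / (u + 1) ^ S m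
           + INR (S m) * INR (fact m) / (u + 1) ^ S (S m))
    with (INR (fact m) * ((1 + INR (S m) * / (u + 1)) * / (u + 1) ^ S m)).
  - lra.
  - change ((u + 1) ^ S (S m)) with ((u + 1) * (u + 1) ^ S m); field; lra.
Qed.

(** This function is the derivative of [log_increment a]. Order 0 is the tangent inequality for [ln]
    at [x + a + 1]; higher orders are [inv_power_sub_ge]. *)
Lemma completely_monotone_ln_sub_sub_inv (a : R) :
  completely_monotone (- a) p_infty
    (fun x => ln (x + (a + 1)) - ln (x + a) - inv_power (a + 1) 0 x).
Proof.
  apply (completely_monotone_of_derivatives (- a)
    (fun m x => match m with
                | O => ln (x + (a + 1)) - ln (x + a) - inv_power (a + 1) 0 x
                | S p => inv_power a p x - inv_power (a + 1) p x
                         - inv_power (a + 1) (S p) x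
                end)).
  - intros [|m] x Hx.
    + assert (H := ln_sub_le (x + (a + 1)) (x + a) ltac:(lra) ltac:(lra)).
      replace ((x + a - (x + (a + 1))) / (x + (a + 1)))
        with (- inv_power (a + 1) 0 x) in H; [lra|].
      unfold inv_power; simpl; field; lra.
    + assert (H := inv_power_sub_ge a m x ltac:(lra)); lra.
  - intros [|m] x Hx.
    + replace (- (inv_power a 0 x - inv_power (a + 1) 0 x - inv_power (a + 1) 1 x))
        with (inv_power (a + 1) 0 x - inv_power a 0 x - - inv_power (a + 1) 1 x) by ring.
      repeat apply (is_derive_minus (K := R_AbsRing) (V := R_NormedModule));
        (apply is_derive_ln_shift || apply is_derive_inv_power); lra.
    + replace (- (inv_power a (S m) x - inv_power (a + 1) (S m) x
                  - inv_power (a + 1) (S (S m)) x))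
        with (- inv_power a (S m) x - - inv_power (a + 1) (S m) x
              - - inv_power (a + 1) (S (S m)) x) by ring.
      repeat apply (is_derive_minus (K := R_AbsRing) (V := R_NormedModule));
        apply is_derive_inv_power; lra.
Qed.

(** The function [h_a] of the series expansion. *)
Definition log_increment (a x : R) : R :=
  (x + a) * (ln (x + (a + 1)) - ln (x + a)).

(** Subtracting the value at 0 gives the primitive that vanishes there, and [a > 0] puts 0 inside
    the ray beyond [- a], so the averaging lemma applies. *)
Lemma completely_monotone_log_increment (a : R) :
  0 < a ->
  completely_monotone 0 p_infty (fun x => (log_increment a x - log_increment a 0) / x).
Proof.
  intro Ha.
  apply (completely_monotone_average (- a)
    (fun x => log_increment a x - log_increment a 0)
    (fun x => ln (x + (a + 1)) - ln (x + a) - inv_power (a + 1) 0 x)).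
  - lra.
  - apply completely_monotone_ln_sub_sub_inv.
  - intros y Hy; unfold log_increment, inv_power; auto_derive; [repeat split; lra|].
    simpl; field; lra.
  - ring.
Qed.

(** * The Gamma integral *)

Notation is_RInt_0_infty f l := (is_RInt_gen f (at_right 0) (Rbar_locally p_infty) l).

Lemma filter_prod_0_infty (P : R -> R -> Prop) (a0 b0 : R) :
  0 < a0 -> (forall a b, 0 < a < a0 -> b0 < b -> P a b) ->
  filter_prod (at_right 0) (Rbar_locally p_infty) (fun ab => P (fst ab) (snd ab)).
Proof.
  intros Ha HP.
  apply (Filter_prod _ _ _ (fun a => 0 < a < a0) (fun b => b0 < b)).
  - exists (mkposreal a0 Ha); intros y Hy Hy0; split; [exact Hy0|].
    change (Rabs (y - 0) < a0) in Hy; apply Rabs_def2 in Hy; lra.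
  - exists b0; auto.
  - intros a b; apply HP.
Qed.

Lemma ex_RInt_continuous_pos (f : R -> R) (a b : R) :
  (forall t, 0 < t -> continuous f t) -> 0 < a -> a <= b -> ex_RInt f a b.
Proof.
  intros Hc Ha Hab; apply (ex_RInt_continuous (V := R_CompleteNormedModule)).
  intros z Hz; rewrite Rmin_left in Hz by lra; apply Hc; lra.
Qed.

(** For nonnegative [f] the improper integral is the supremum of the integrals over compact
    intervals, because enlarging an interval can only increase its integral. *)
Lemma is_RInt_gen_bounded (f : R -> R) (M : R) :
  (forall t, 0 < t -> continuous f t) -> (forall t, 0 < t -> 0 <= f t) ->
  (forall a b, 0 < a <= b -> RInt f a b <= M) ->
  exists l, is_RInt_0_infty f l /\ forall a b, 0 < a <= b -> RInt f a b <= l.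
Proof.
  intros Hc Hpos HM.
  destruct (completeness (fun y => exists a b, 0 < a <= b /\ y = RInt f a b))
    as [l [Hub Hlub]].
  { exists M; intros y (a & b & Hab & ->); now apply HM. }
  { exists (RInt f 1 1), 1, 1; split; [lra | reflexivity]. }
  assert (Hle : forall a b, 0 < a <= b -> RInt f a b <= l).
  { intros a b Hab; apply Hub; now exists a, b. }
  exists l; split; [|exact Hle].
  intros P [e He].
  (* If no interval came within [e] of [l], then [l - e] would be a smaller upper bound. *)
  destruct (Classical_Prop.classic (exists a b, 0 < a <= b /\ l - e < RInt f a b))
    as [(a0 & b0 & Hab0 & H0) | Hno].
  - apply (filter_prod_0_infty (fun a b => exists y, is_RInt f a b y /\ P y) a0 b0);
      [lra|].
    intros a b Ha Hb; exists (RInt f a b); split.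
    + apply (RInt_correct (V := R_CompleteNormedModule)).
      apply ex_RInt_continuous_pos; auto; lra.
    + apply He; change (Rabs (RInt f a b - l) < e).
      assert (RInt f a b <= l) by (apply Hle; lra).
      assert (RInt f a0 b0 <= RInt f a b).
      { assert (E : RInt f a b = RInt f a a0 + RInt f a0 b0 + RInt f b0 b).
        { rewrite <- (RInt_Chasles f a b0 b), <- (RInt_Chasles f a a0 b0);
            try reflexivity; apply ex_RInt_continuous_pos; auto; lra. }
        assert (0 <= RInt f a a0).
        { apply RInt_ge_0; [lra | apply ex_RInt_continuous_pos; auto; lra|].
          intros; apply Hpos; lra. }
        assert (0 <= RInt f b0 b); [|lra].
        apply RInt_ge_0; [lra | apply ex_RInt_continuous_pos; auto; lra|].
        intros; apply Hpos; lra. }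
      apply Rabs_def1; lra.
  - exfalso; assert (l <= l - e); [|destruct e; simpl in *; lra].
    apply Hlub; intros y (a & b & Hab & ->).
    apply Rnot_lt_le; intro H; apply Hno; now exists a, b.
Qed.

Lemma is_RInt_gen_0_infty_le (f g : R -> R) (lf lg : R) :
  (forall t, 0 < t -> 0 <= f t <= g t) ->
  is_RInt_0_infty f lf -> is_RInt_0_infty g lg -> lf <= lg.
Proof.
  intros Hfg Hf Hg.
  apply Rle_trans with (Rabs lf); [apply Rle_abs|].
  apply (RInt_gen_norm (V := R_CompleteNormedModule)
          (Fa := at_right 0) (Fb := Rbar_locally p_infty) f g lf lg); auto.
  - apply (filter_prod_0_infty (fun a b => a <= b) 1 1); intros; lra.
  - apply (filter_prod_0_infty
            (fun a b => forall x, a <= x <= b -> norm (f x) <= g x) 1 1); [lra|].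
    intros a b Ha Hb x Hx; change (Rabs (f x) <= g x).
    destruct (Hfg x) as [H1 H2]; [lra|]; now rewrite Rabs_pos_eq.
Qed.

Lemma is_RInt_gen_0_infty_ext (f g : R -> R) (l : R) :
  (forall t, 0 < t -> f t = g t) -> is_RInt_0_infty f l -> is_RInt_0_infty g l.
Proof.
  intro Hfg; apply (is_RInt_gen_ext (V := R_NormedModule)).
  apply (filter_prod_0_infty
          (fun a b => forall x, Rmin a b < x < Rmax a b -> f x = g x) 1 1); [lra|].
  intros a b Ha Hb x Hx; rewrite Rmin_left in Hx by lra; apply Hfg; lra.
Qed.

Lemma is_RInt_gen_0_infty_lin (f g : R -> R) (a b lf lg : R) :
  is_RInt_0_infty f lf -> is_RInt_0_infty g lg ->
  is_RInt_0_infty (fun t => a * f t + b * g t) (a * lf + b * lg).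
Proof.
  intros Hf Hg.
  apply (is_RInt_gen_plus (V := R_NormedModule) (Fa := at_right 0)
    (Fb := Rbar_locally p_infty) (fun t => a * f t) (fun t => b * g t));
    now apply (is_RInt_gen_scal (V := R_NormedModule)).
Qed.

Lemma exp_le_exp (x y : R) : x <= y -> exp x <= exp y.
Proof. intros [Hlt | ->]; [now apply Rlt_le, exp_increasing | lra]. Qed.

(** The exponent is [s], not [s - 1]: this is the integrand of [Gamma (s + 1)]. *)
Definition gamma_integrand (s t : R) : R := Rpower t s * exp (- t).

Lemma gamma_integrand_gt0 (s t : R) : 0 < gamma_integrand s t.
Proof. apply Rmult_lt_0_compat; apply exp_pos. Qed.

Lemma gamma_integrand_succ (s t : R) :
  0 < t -> gamma_integrand (s + 1) t = t * gamma_integrand s t.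
Proof.
  intro Ht; unfold gamma_integrand; rewrite Rpower_plus, Rpower_1 by exact Ht; ring.
Qed.

Lemma is_derive_gamma_integrand (s t : R) :
  0 < t ->
  is_derive (gamma_integrand s) t (s * gamma_integrand (s - 1) t - gamma_integrand s t).
Proof.
  intro Ht.
  replace (s * gamma_integrand (s - 1) t - gamma_integrand s t)
    with (s * / t * gamma_integrand s t - gamma_integrand s t).
  - unfold gamma_integrand, Rpower; auto_derive; [exact Ht|]; field; lra.
  - replace s with (s - 1 + 1) at 2 by ring; rewrite gamma_integrand_succ by exact Ht.
    field; lra.
Qed.

Lemma continuous_gamma_integrand (s t : R) : 0 < t -> continuous (gamma_integrand s) t.
Proof.
  intro Ht; apply (ex_derive_continuous (V := R_NormedModule)).
  eexists; now apply is_derive_gamma_integrand.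
Qed.

(** The tangent to [ln] at [c] gives [s ln t <= s ln c + s t / c], and a large [c] makes the last
    term at most [t / 2], half of the exponential decay. *)
Lemma gamma_integrand_decay (s : R) :
  0 <= s -> exists C, 0 < C /\ forall t, 0 < t -> gamma_integrand s t <= C * exp (- t / 2).
Proof.
  (* This gives [s / c <= 1 / 2] and keeps [c] positive when [s = 0]. *)
  intro Hs; set (c := 2 * (s + 1)).
  assert (Hc : 0 < c) by (unfold c; lra).
  exists (exp (s * ln c)); split; [apply exp_pos|].
  intros t Ht; unfold gamma_integrand, Rpower; rewrite <- !exp_plus.
  assert (H : s * ln t <= s * ln c + t / 2).
  { assert (Hl := ln_sub_le c t Hc Ht).
    assert (Hl' : ln t <= ln c + t / c).
    { replace ((t - c) / c) with (t / c - 1) in Hl by (field; lra); lra. }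
    apply Rmult_le_compat_l with (r := s) in Hl'; [|exact Hs].
    assert (s * (t / c) <= t / 2); [|lra].
    apply Rmult_le_reg_l with c; [exact Hc|].
    replace (c * (s * (t / c))) with (s * t) by (field; lra).
    unfold c; nra. }
  apply exp_le_exp; lra.
Qed.

(** The majorant [C * exp (- t / 2)] has integral below [2 * C] on every interval. The bound on
    partial integrals is kept in the conclusion to prove [Gamma] positive later. *)
Lemma exists_gamma_integral (s : R) :
  0 <= s ->
  exists l, is_RInt_0_infty (gamma_integrand s) l /\
    forall a b, 0 < a <= b -> RInt (gamma_integrand s) a b <= l.
Proof.
  intro Hs; destruct (gamma_integrand_decay s Hs) as (C & HC & Hdec).
  apply is_RInt_gen_bounded with (2 * C).
  - intros; now apply continuous_gamma_integrand.
  - intros; apply Rlt_le, gamma_integrand_gt0.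
  - intros a b Hab.
    assert (HI : is_RInt (fun t => C * exp (- t / 2)) a b
                   (-2 * C * exp (- b / 2) - -2 * C * exp (- a / 2))).
    { apply (is_RInt_derive (V := R_CompleteNormedModule)
              (fun t => -2 * C * exp (- t / 2)) (fun t => C * exp (- t / 2))).
      - intros x _; auto_derive; [exact I|]; unfold Rdiv; field.
      - intros x _; apply (ex_derive_continuous (V := R_NormedModule)).
        auto_derive; exact I. }
    apply Rle_trans with (RInt (fun t => C * exp (- t / 2)) a b).
    + apply RInt_le; [lra | | eexists; exact HI | intros; apply Hdec; lra].
      apply ex_RInt_continuous_pos; [intros; now apply continuous_gamma_integrand | lra | lra].
    + rewrite (is_RInt_unique _ _ _ _ HI).
      assert (0 < exp (- b / 2)) by apply exp_pos.
      assert (exp (- a / 2) < 1) by (rewrite <- exp_0; apply exp_increasing; lra).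
      nra.
Qed.

Lemma is_RInt_0_infty_unique (f : R -> R) (l : R) :
  is_RInt_0_infty f l -> RInt_gen f (at_right 0) (Rbar_locally p_infty) = l.
Proof.
  intro H; exact (is_RInt_gen_unique (V := R_CompleteNormedModule)
    (Fa := at_right 0) (Fb := Rbar_locally p_infty) f l H).
Qed.

Lemma is_RInt_gen_Gamma (x : R) :
  1 <= x -> is_RInt_0_infty (gamma_integrand (x - 1)) (Gamma x).
Proof.
  intro Hx; destruct (exists_gamma_integral (x - 1)) as (l & Hl & _); [lra|].
  replace (Gamma x) with l; [exact Hl|].
  symmetry; exact (is_RInt_0_infty_unique (gamma_integrand (x - 1)) l Hl).
Qed.

Lemma Gamma_gt0 (x : R) : 1 <= x -> 0 < Gamma x.
Proof.
  intro Hx; destruct (exists_gamma_integral (x - 1)) as (l & Hl & Hle); [lra|].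
  replace (Gamma x) with l.
  2: { symmetry; exact (is_RInt_0_infty_unique (gamma_integrand (x - 1)) l Hl). }
  apply Rlt_le_trans with (2 := Hle 1 2 ltac:(lra)).
  apply RInt_gt_0; [lra | intros; apply gamma_integrand_gt0|].
  intros; apply continuous_gamma_integrand; lra.
Qed.

Lemma filterlim_gamma_integrand_0 (s : R) :
  1 <= s -> filterlim (gamma_integrand s) (at_right 0) (locally 0).
Proof.
  intro Hs; apply filterlim_locally; intros [e He].
  assert (Hm : 0 < Rmin 1 e) by (apply Rmin_pos; lra).
  exists (mkposreal _ Hm); intros t Ht Ht0.
  change (Rabs (t - 0) < Rmin 1 e) in Ht; apply Rabs_def2 in Ht.
  assert (Rmin 1 e <= 1) by apply Rmin_l; assert (Rmin 1 e <= e) by apply Rmin_r.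
  change (Rabs (gamma_integrand s t - 0) < e).
  rewrite Rminus_0_r, Rabs_pos_eq by apply Rlt_le, gamma_integrand_gt0.
  replace s with (s - 1 + 1) by ring; rewrite gamma_integrand_succ by exact Ht0.
  (* For [t < 1] the exponent [(s - 1) * ln t - t] is at most 0, so the integrand with exponent [s]
     is at most [t]. *)
  assert (gamma_integrand (s - 1) t <= 1); [|nra].
  unfold gamma_integrand, Rpower; rewrite <- exp_plus.
  apply Rle_trans with (exp 0); [apply exp_le_exp | rewrite exp_0; lra].
  assert (ln t <= t - 1) by now apply ln_le_sub1.
  nra.
Qed.

Lemma filterlim_gamma_integrand_infty (s : R) :
  0 <= s -> filterlim (gamma_integrand s) (Rbar_locally p_infty) (locally 0).
Proof.
  intro Hs; destruct (gamma_integrand_decay s Hs) as (C & HC & Hdec).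
  apply filterlim_locally; intros [e He].
  (* Beyond this threshold [exp (t / 2) >= 1 + t / 2 > C / e]. *)
  exists (2 * C / e); intros t Ht.
  assert (0 < 2 * C / e) by (apply Rdiv_lt_0_compat; lra).
  change (Rabs (gamma_integrand s t - 0) < e).
  rewrite Rminus_0_r, Rabs_pos_eq by apply Rlt_le, gamma_integrand_gt0.
  apply Rle_lt_trans with (1 := Hdec t ltac:(lra)).
  assert (He2 := exp_ineq1_le (t / 2)); assert (Hp := exp_pos (t / 2)).
  replace (- t / 2) with (- (t / 2)) by field; rewrite exp_Ropp.
  apply Rmult_lt_reg_r with (exp (t / 2)); [exact Hp|].
  replace (C * / exp (t / 2) * exp (t / 2)) with C by (field; lra).
  apply Rmult_lt_compat_r with (r := e) in Ht; [|exact He].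
  replace (2 * C / e * e) with (2 * C) in Ht by (field; lra); nra.
Qed.

(** The fundamental theorem of calculus with limit 0 at infinity. It serves with [s = 0], [l = 1]
    for [Gamma 1], and with [s >= 1], [l = 0] for the functional equation. *)
Lemma is_RInt_0_infty_Derive_gamma_integrand (s l : R) :
  0 <= s -> filterlim (gamma_integrand s) (at_right 0) (locally l) ->
  is_RInt_0_infty (Derive (gamma_integrand s)) (0 - l).
Proof.
  intros Hs Hl; apply is_RInt_gen_Derive.
  - apply (filter_prod_0_infty (fun a b => forall t, Rmin a b <= t <= Rmax a b ->
            ex_derive (gamma_integrand s) t) 1 1); [lra|].
    intros a b Ha Hb t Ht; rewrite Rmin_left in Ht by lra.
    eexists; apply is_derive_gamma_integrand; lra.
  - apply (filter_prod_0_infty (fun a b => forall t, Rmin a b <= t <= Rmax a b ->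
            continuous (Derive (gamma_integrand s)) t) 1 1); [lra|].
    intros a b Ha Hb t Ht; rewrite Rmin_left in Ht by lra.
    apply continuous_ext_loc
      with (fun u => s * gamma_integrand (s - 1) u - gamma_integrand s u).
    + apply (filter_imp (fun u => 0 < u)); [|apply locally_Rlt; lra].
      intros u Hu; symmetry; apply is_derive_unique; now apply is_derive_gamma_integrand.
    + apply (continuous_minus (V := R_NormedModule));
        [apply (continuous_scal_r (V := R_NormedModule) s)|];
        apply continuous_gamma_integrand; lra.
  - exact Hl.
  - now apply filterlim_gamma_integrand_infty.
Qed.

Lemma Gamma_1 : Gamma 1 = 1.
Proof.
  assert (Hl : filterlim (gamma_integrand 0) (at_right 0) (locally 1)).
  { apply filterlim_ext with (fun t => exp (- t)).
    - intro t; unfold gamma_integrand, Rpower; rewrite Rmult_0_l, exp_0; ring.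
    - assert (Hc : continuous (fun t => exp (- t)) 0).
      { apply (ex_derive_continuous (V := R_NormedModule)); auto_derive; exact I. }
      unfold continuous in Hc; rewrite Ropp_0, exp_0 in Hc.
      eapply filterlim_filter_le_1; [apply filter_le_within | exact Hc]. }
  assert (Hd := is_RInt_0_infty_Derive_gamma_integrand 0 1 ltac:(lra) Hl).
  (* The coefficients [-1] and [0] merely negate the integral, as [exp (- t)] is minus its own
     derivative. *)
  assert (HG := is_RInt_gen_0_infty_lin _ _ (-1) 0 _ _ Hd Hd).
  replace 1 with (-1 * (0 - 1) + 0 * (0 - 1)) at 2 by ring.
  apply (is_RInt_0_infty_unique (gamma_integrand (1 - 1))).
  apply is_RInt_gen_0_infty_ext with (2 := HG).
  intros t Ht.
  rewrite (is_derive_unique _ _ _ (is_derive_gamma_integrand 0 t Ht)).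
  replace (1 - 1) with 0 by ring; ring.
Qed.

(** Integration by parts: the two integrands differ by the derivative of [gamma_integrand x], whose
    integral vanishes because the boundary limits are 0. *)
Lemma Gamma_succ (x : R) : 1 <= x -> Gamma (x + 1) = x * Gamma x.
Proof.
  intro Hx.
  assert (Hd := is_RInt_0_infty_Derive_gamma_integrand x 0 ltac:(lra)
    (filterlim_gamma_integrand_0 x Hx)).
  replace (x * Gamma x) with (x * Gamma x + -1 * (0 - 0)) by ring.
  apply (is_RInt_0_infty_unique (gamma_integrand (x + 1 - 1))).
  apply is_RInt_gen_0_infty_ext with (2 := is_RInt_gen_0_infty_lin _ _ x (-1) _ _
    (is_RInt_gen_Gamma x Hx) Hd).
  intros t Ht.
  rewrite (is_derive_unique _ _ _ (is_derive_gamma_integrand x t Ht)).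
  replace (x + 1 - 1) with x by ring; ring.
Qed.

(** Convexity of [exp]: the tangent bounds from [x * v] to 0 and to [v], weighted by [1 - x] and
    [x], have cancelling linear terms. *)
Lemma exp_mult_le_chord (v x : R) :
  0 <= x <= 1 -> exp (x * v) <= 1 - x + x * exp v.
Proof.
  intro Hx.
  assert (Htan : forall w, exp (x * v) * (1 + (w - x * v)) <= exp w).
  { intro w; replace (exp w) with (exp (x * v) * exp (w - x * v)).
    - apply Rmult_le_compat_l; [apply Rlt_le, exp_pos | apply exp_ineq1_le].
    - rewrite <- exp_plus; f_equal; ring. }
  assert (H0 := Htan 0); assert (H1 := Htan v); rewrite exp_0 in H0.
  apply Rmult_le_compat_l with (r := 1 - x) in H0; [|lra].
  apply Rmult_le_compat_l with (r := x) in H1; [|lra].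
  nra.
Qed.

(* Integrate the tangent bound t^x <= y^x (1 - x + x t / y) against t^(y-1) e^(-t). *)
Lemma Gamma_add_le (y x : R) :
  1 <= y -> 0 <= x <= 1 -> Gamma (y + x) <= Rpower y x * Gamma y.
Proof.
  intros Hy Hx.
  assert (H := is_RInt_gen_0_infty_lin _ _ (Rpower y x * (1 - x)) (Rpower y x * x / y)
    _ _ (is_RInt_gen_Gamma y Hy) (is_RInt_gen_Gamma (y + 1) ltac:(lra))).
  (* As [Gamma (y + 1) = y * Gamma y], the weights [1 - x] and [x] recombine to 1. *)
  replace (Rpower y x * Gamma y)
    with (Rpower y x * (1 - x) * Gamma y + Rpower y x * x / y * Gamma (y + 1))
    by (rewrite Gamma_succ by exact Hy; field; lra).
  apply is_RInt_gen_0_infty_le with (2 := is_RInt_gen_Gamma (y + x) ltac:(lra)) (3 := H).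
  intros t Ht; split; [apply Rlt_le, gamma_integrand_gt0|].
  replace (y + 1 - 1) with (y - 1 + 1) by ring; rewrite gamma_integrand_succ by exact Ht.
  replace (gamma_integrand (y + x - 1) t) with (Rpower t x * gamma_integrand (y - 1) t).
  2: { unfold gamma_integrand; rewrite <- Rmult_assoc, <- Rpower_plus.
       now replace (x + (y - 1)) with (y + x - 1) by ring. }
  assert (Hc : Rpower t x <= Rpower y x * (1 - x + x * (t / y))).
  { assert (Hch := exp_mult_le_chord (ln (t / y)) x Hx).
    rewrite exp_ln in Hch by (apply Rdiv_lt_0_compat; lra).
    replace (Rpower t x) with (Rpower y x * exp (x * ln (t / y))).
    - apply Rmult_le_compat_l; [apply Rlt_le, exp_pos | exact Hch].
    - rewrite ln_div by lra; unfold Rpower; rewrite <- exp_plus; f_equal; ring. }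
  assert (Hg := gamma_integrand_gt0 (y - 1) t).
  apply Rmult_le_compat_r with (r := gamma_integrand (y - 1) t) in Hc; [|lra].
  replace (Rpower y x * (1 - x) * gamma_integrand (y - 1) t
           + Rpower y x * x / y * (t * gamma_integrand (y - 1) t))
    with (Rpower y x * (1 - x + x * (t / y)) * gamma_integrand (y - 1) t); [exact Hc|].
  field; lra.
Qed.

(** * Logarithmic asymptotics of Gamma and the series expansion *)

Lemma ln_Gamma_succ (x : R) :
  1 <= x -> ln (Gamma (x + 1)) = ln x + ln (Gamma x).
Proof.
  intro Hx; rewrite Gamma_succ by exact Hx; apply ln_mult; [lra | now apply Gamma_gt0].
Qed.

Lemma ln_Gamma_add_le (y x : R) :
  1 <= y -> 0 <= x <= 1 -> ln (Gamma (y + x)) <= x * ln y + ln (Gamma y).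
Proof.
  intros Hy Hx; rewrite <- (ln_exp (x * ln y)).
  rewrite <- ln_mult; [|apply exp_pos | now apply Gamma_gt0].
  apply ln_le; [apply Gamma_gt0; lra | now apply Gamma_add_le].
Qed.

(** The logarithmic error in the asymptotics [Gamma (y + x) ~ y^x Gamma y] for large [y]. *)
Definition stirling_defect (y x : R) : R :=
  ln (Gamma (y + x)) - ln (Gamma y) - x * ln y.

(** [ln_Gamma_add_le] from [y] to [y + x] makes the defect nonpositive. Applied from [y + x] to
    [y + 1], it bounds the defect below by [- (1 - x) * (ln (y + x) - ln y)], hence by
    [- (1 - x) * x / y]. *)
Lemma stirling_defect_bound_le1 (x y : R) :
  0 <= x <= 1 -> 1 <= y -> Rabs (stirling_defect y x) <= 1 / y.
Proof.
  intros Hx Hy; unfold stirling_defect.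
  assert (Hup := ln_Gamma_add_le y x Hy Hx).
  assert (Hlow := ln_Gamma_add_le (y + x) (1 - x) ltac:(lra) ltac:(lra)).
  replace (y + x + (1 - x)) with (y + 1) in Hlow by ring.
  rewrite ln_Gamma_succ in Hlow by exact Hy.
  assert (Hl := ln_sub_le y (y + x) ltac:(lra) ltac:(lra)).
  replace ((y + x - y) / y) with (x * (1 / y)) in Hl by (field; lra).
  assert (Hy' : 0 < 1 / y) by (apply Rdiv_lt_0_compat; lra).
  set (d := 1 / y) in *.
  assert (Hd : (1 - x) * (ln (y + x) - ln y) <= (1 - x) * (x * d)).
  { apply Rmult_le_compat_l; lra. }
  assert ((1 - x) * (x * d) <= d) by (assert (0 <= x * x) by nra; nra).
  apply Rabs_le; split; lra.
Qed.

Lemma stirling_defect_bound (x : R) :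
  0 <= x -> exists C, forall y, 1 <= y -> Rabs (stirling_defect y x) <= C / y.
Proof.
  assert (Hn : forall n x, 0 <= x <= INR n + 1 ->
    exists C, forall y, 1 <= y -> Rabs (stirling_defect y x) <= C / y).
  { clear x; induction n as [|n IH]; intros x Hx.
    - exists 1; intros y Hy; apply stirling_defect_bound_le1; simpl in Hx; lra.
    - destruct (Rle_lt_dec x 1) as [Hx1 | Hx1].
      + exists 1; intros y Hy; apply stirling_defect_bound_le1; lra.
      + rewrite S_INR in Hx; destruct (IH (x - 1)) as [C HC]; [lra|].
        (* Passing from [x - 1] to [x] adds [ln (y + (x - 1)) - ln y], which lies between 0 and
           [(x - 1) / y]. *)
        exists (C + (x - 1)); intros y Hy.
        replace (stirling_defect y x)
          with (stirling_defect y (x - 1) + (ln (y + (x - 1)) - ln y)).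
        2: { unfold stirling_defect; replace (y + x) with (y + (x - 1) + 1) by ring.
             rewrite ln_Gamma_succ by lra; ring. }
        apply Rle_trans with (1 := Rabs_triang _ _).
        assert (Hl := ln_sub_le y (y + (x - 1)) ltac:(lra) ltac:(lra)).
        assert (ln y <= ln (y + (x - 1))) by (apply ln_le; lra).
        rewrite (Rabs_pos_eq (ln _ - _)) by lra.
        replace ((C + (x - 1)) / y) with (C / y + (y + (x - 1) - y) / y) by (field; lra).
        specialize (HC y Hy); lra. }
  intro Hx; destruct (INR_unbounded x) as [n Hlt]; apply (Hn n); lra.
Qed.

(** Writing [x + a = (x + a + 1) - 1] in front of [ln (x + a + 1)] makes the products telescope. The
    leftover logarithms form a quotient of Gamma values; the index [k] stands for [a = k + 1]. *)
Lemma sum_log_increment (x : R) (n : nat) :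
  0 <= x ->
  sum_f_R0 (fun k => log_increment (INR k + 1) x) n =
  (INR n + 2 + x) * ln (INR n + 2 + x) - x * ln (1 + x)
  + ln (Gamma (1 + x)) - ln (Gamma (INR n + 3 + x)).
Proof.
  intro Hx; induction n as [|n IH].
  - simpl sum_f_R0; unfold log_increment; simpl INR.
    replace (0 + 3 + x) with (1 + x + 1 + 1) by ring.
    rewrite !ln_Gamma_succ by lra.
    replace (x + (0 + 1)) with (1 + x) by ring.
    replace (x + (0 + 1 + 1)) with (1 + x + 1) by ring.
    replace (0 + 2 + x) with (1 + x + 1) by ring; ring.
  - cbn [sum_f_R0]; rewrite IH, S_INR.
    assert (Hn := pos_INR n).
    unfold log_increment.
    replace (INR n + 1 + 3 + x) with (INR n + 3 + x + 1) by ring.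
    rewrite (ln_Gamma_succ (INR n + 3 + x)) by lra.
    replace (x + (INR n + 1 + 1)) with (INR n + 2 + x) by ring.
    replace (x + (INR n + 1 + 1 + 1)) with (INR n + 3 + x) by ring.
    replace (INR n + 1 + 2 + x) with (INR n + 3 + x) by ring; ring.
Qed.

Lemma is_series_log_increment (x : R) :
  0 < x ->
  is_series (fun k => (log_increment (INR k + 1) x - log_increment (INR k + 1) 0) / x)
    (1 + 1 / x * ln (Gamma (x + 1)) - ln (x + 1)).
Proof.
  intro Hx; destruct (stirling_defect_bound x ltac:(lra)) as [C HC].
  (* The summands bound, in units of [1 / N] with [N = n + 2], the three errors [HA], [HB'] and
     [HC'] below. *)
  set (K := (x * x + x * (1 + x) + C) / x).
  assert (Hsum : forall n,
    sum_f_R0 (fun k => (log_increment (INR k + 1) x - log_increment (INR k + 1) 0) / x) n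
    = (sum_f_R0 (fun k => log_increment (INR k + 1) x) n
       - sum_f_R0 (fun k => log_increment (INR k + 1) 0) n) / x).
  { induction n as [|n IH]; [reflexivity|].
    cbn [sum_f_R0]; rewrite IH; field; lra. }
  assert (Hbound : forall n,
    Rabs (sum_f_R0 (fun k => (log_increment (INR k + 1) x - log_increment (INR k + 1) 0) / x) n
          - (1 + 1 / x * ln (Gamma (x + 1)) - ln (x + 1))) <= K / (INR n + 2)).
  { intro n; rewrite Hsum, !sum_log_increment by lra.
    assert (Hn := pos_INR n).
    set (N := INR n + 2); replace (INR n + 3) with (N + 1) by (unfold N; ring).
    assert (HN : 2 <= N) by (unfold N; lra).
    rewrite !Rplus_0_r, Rmult_0_l; replace (1 + x) with (x + 1) by ring.
    rewrite Gamma_1, ln_1.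
    specialize (HC (N + 1) ltac:(lra)).
    (* The difference of the two sums is [x] times the limit plus three errors, each of order
       [1 / N]. *)
    assert (E : (N + x) * ln (N + x) - x * ln (x + 1) + ln (Gamma (x + 1))
                - ln (Gamma (N + 1 + x))
                - (N * ln N - 0 + 0 - ln (Gamma (N + 1)))
              = x * (1 + 1 / x * ln (Gamma (x + 1)) - ln (x + 1))
                + ((N * (ln (N + x) - ln N) - x) + x * (ln (N + x) - ln (N + 1))
                   - stirling_defect (N + 1) x)).
    { unfold stirling_defect; field; lra. }
    rewrite E; clear E.
    set (d := / N); assert (Hd : 0 < d) by (apply Rinv_0_lt_compat; lra).
    assert (HC' : Rabs (stirling_defect (N + 1) x) <= C * d).
    (* Nonnegativity of [C], read off from the bound itself, allows weakening [C / (N + 1)] to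
       [C / N]. *)
    { assert (0 <= C).
      { assert (HC0 := Rle_trans _ _ _ (Rabs_pos _) HC).
        apply Rmult_le_compat_r with (r := N + 1) in HC0; [|lra].
        replace (C / (N + 1) * (N + 1)) with C in HC0 by (field; lra); lra. }
      apply Rle_trans with (1 := HC), Rmult_le_compat_l; [assumption|].
      apply Rinv_le_contravar; lra. }
    assert (HA : - (x * x * d) <= N * (ln (N + x) - ln N) - x <= 0).
    { assert (H1 := ln_sub_le N (N + x) ltac:(lra) ltac:(lra)).
      assert (H2 := ln_sub_le (N + x) N ltac:(lra) ltac:(lra)).
      apply Rmult_le_compat_l with (r := N) in H1, H2; try lra.
      replace (N * ((N + x - N) / N)) with x in H1 by (field; lra).
      replace (N * ((N - (N + x)) / (N + x))) with (x * x * / (N + x) - x) in H2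
        by (field; lra).
      assert (x * x * / (N + x) <= x * x * d); [|lra].
      apply Rmult_le_compat_l; [nra | apply Rinv_le_contravar; lra]. }
    (* The sign depends on whether [x] exceeds 1; [|x - 1| <= 1 + x] covers both cases. *)
    assert (HB : - ((1 + x) * d) <= ln (N + x) - ln (N + 1) <= (1 + x) * d).
    { assert (H1 := ln_sub_le (N + 1) (N + x) ltac:(lra) ltac:(lra)).
      assert (H2 := ln_sub_le (N + x) (N + 1) ltac:(lra) ltac:(lra)).
      assert (I1 : / (N + 1) <= d) by (apply Rinv_le_contravar; lra).
      assert (I2 : / (N + x) <= d) by (apply Rinv_le_contravar; lra).
      assert (0 < / (N + 1)) by (apply Rinv_0_lt_compat; lra).
      assert (0 < / (N + x)) by (apply Rinv_0_lt_compat; lra).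
      unfold Rdiv in H1, H2; split; nra. }
    assert (HB' : - (x * (1 + x) * d) <= x * (ln (N + x) - ln (N + 1)) <= x * (1 + x) * d)
      by (split; nra).
    apply Rabs_le_between in HC'.
    replace (K / N) with ((x * x + x * (1 + x) + C) * d / x)
      by (unfold K, d; field; lra).
    match goal with |- Rabs ((x * ?f + ?e) / x - ?f) <= _ =>
      replace ((x * f + e) / x - f) with (e / x) by (field; lra) end.
    unfold Rdiv; rewrite Rabs_mult, (Rabs_pos_eq (/ x))
      by (apply Rlt_le, Rinv_0_lt_compat, Hx).
    apply Rmult_le_compat_r; [apply Rlt_le, Rinv_0_lt_compat, Hx|].
    apply Rabs_le; lra. }
  apply is_series_Reals; intros e He.
  destruct (INR_unbounded (K / e)) as [n0 Hn0]; exists n0; intros n Hn.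
  apply Rle_lt_trans with (1 := Hbound n).
  apply le_INR in Hn; assert (Hp := pos_INR n).
  assert (HKn : K / e < INR n + 2) by lra.
  apply Rmult_lt_compat_r with (r := e) in HKn; [|exact He].
  replace (K / e * e) with K in HKn by (field; lra).
  apply Rmult_lt_reg_r with (INR n + 2); [lra|].
  replace (K / (INR n + 2) * (INR n + 2)) with K by (field; lra); lra.
Qed.

Theorem theorem2p22 (beta : R) (hbeta : 0 <= beta <= 1) :
  completely_monotone 0 p_infty
    (fun x : R => 1 + 1 / x * ln (Gamma (x + 1)) - ln (x + beta)).
Proof.
  apply completely_monotone_ext with (fun x =>
    (1 + 1 / x * ln (Gamma (x + 1)) - ln (x + 1)) + (ln (x + 1) - ln (x + beta))).
  { intros; ring. }
  apply completely_monotone_plus.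
  - apply completely_monotone_series with (fun k x =>
      (log_increment (INR k + 1) x - log_increment (INR k + 1) 0) / x).
    + intro k; apply completely_monotone_log_increment.
      assert (H := pos_INR k); lra.
    + exact is_series_log_increment.
  (* The logarithmic difference is completely monotone beyond [- beta], a ray containing all
     positive [x] because [beta >= 0]. *)
  - intros n x Hx; simpl in Hx.
    apply (completely_monotone_ln_sub beta 1); simpl; lra.
Qed.
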